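(* Let $n\ge2$ and, for $1\le a<b\le n$, let $$A_n(a,b)=\frac{(n-2)!\,a^{a-2}(b-a)^{b-a-2}(n-b+1)^{n-b-1}}{(a-1)!\,(b-a-1)!\,(n-b)!\,(n+1)^{n-1}}.$$ Then $$P_n^{\text{park}}(\sigma^{-1}_{n-1}=l,\ \sigma^{-1}_n=m)=\begin{cases}l\,m\,A_n(l,m),&\text{if }1\le l<m\le n;\\ (l-m)\,m\,A_n(m,l),&\text{if }1\le m<l\le n.\end{cases}$$
   Context: $[n]=\{1,\dots,n\}$ and $S_n$ is the set of permutations $\sigma=\sigma_1\cdots\sigma_n$ of $[n]$; $\sigma^{-1}_k=j$ if and only if $\sigma_j=k$. Parking: cars $1,\dots,n$ arrive in this order on a one-way street with spaces $1,\dots,n$; given a sequence $\pi=(\pi_1,\dots,\pi_n)\in[n]^n$ of preferred spaces, car $i$ parks in space $\pi_i$ if it is free, and otherwise in the first free space with number greater than $\pi_i$, if one exists (if none exists the car exits the street). $\pi$ is a parking function on $[n]$ if all $n$ cars are able to park; $\mathcal{P}_n$ is the set of parking functions on $[n]$. The map $T_n:\mathcal{P}_n\to S_n$ is $T_n(\pi)=\sigma$, where $\sigma_j$ is the number of the car that parked in space $j$, $j\in[n]$. The probability measure $P_n^{\text{park}}$ on $S_n$ is $P_n^{\text{park}}(\sigma)=|T_n^{-1}(\{\sigma\})|/|\mathcal{P}_n|$. *)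

(* Defs.v *)
From HB Require Import structures.
From mathcomp Require Import all_boot all_order all_fingroup all_algebra.
Set Implicit Arguments.
Unset Strict Implicit.
Unset Printing Implicit Defensive.
Import Order.TTheory GRing.Theory Num.Theory.
Local Open Scope ring_scope.

(* Cars and spaces are numbered from 1 in the mathematics; both are represented
   by 'I_n, the ordinal i standing for the number i.+1. *)

Section Parking.
Variable n : nat.
Implicit Types (pref : {ffun 'I_n -> 'I_n}) (s : 'S_n).

(* The space j holds the car i if st j = Some i, and is free if st j = None. *)
Definition street := {ffun 'I_n -> option 'I_n}.

(* enum 'I_n is increasing, so ohead returns the first suitable space. *)
Definition choose_space (st : street) (p : 'I_n) : option 'I_n :=
  if st p == None then Some p
  else ohead [seq j : 'I_n <- enum 'I_n | (p < j)%N && (st j == None)].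

Definition park_car pref (st : street) (i : 'I_n) : street :=
  if choose_space st (pref i) is Some j0
  then [ffun j => if j == j0 then Some i else st j]
  else st.

Definition final_street pref : street :=
  foldl (park_car pref) [ffun=> None] (enum 'I_n).

Definition is_parking pref : bool :=
  [forall i, [exists j, final_street pref j == Some i]].

Definition parking_function := {pref : {ffun 'I_n -> 'I_n} | is_parking pref}.

(* The default j is never used when pref is a parking function, see car_atE. *)
Definition car_at pref (j : 'I_n) : 'I_n := odflt j (final_street pref j).

Lemma car_at_surj pref : is_parking pref ->
  {g : 'I_n -> 'I_n | cancel (car_at pref) g &
     forall i, final_street pref (g i) = Some i}.
Proof.
move=> /forallP pk.
pose g i := xchoose (existsP (pk i)).
have gE i : final_street pref (g i) = Some i.
  exact/eqP/(xchooseP (existsP (pk i))).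
have gK : cancel g (car_at pref) by move=> i; rewrite /car_at gE.
exists g => //.
exact: (proj2 (bij_can_sym (injF_bij (can_inj gK)) (car_at pref)) gK).
Qed.

Lemma car_at_inj pref : is_parking pref -> injective (car_at pref).
Proof. by case/car_at_surj=> g carK _; apply: can_inj carK. Qed.

Lemma car_atE pref j : is_parking pref -> final_street pref j = Some (car_at pref j).
Proof. by case/car_at_surj=> g carK gE; rewrite -{1}(carK j) gE. Qed.

Definition park_perm (p : parking_function) : 'S_n :=
  perm (car_at_inj (valP p)).

Definition park_mass s : rat :=
  #|park_perm @^-1: [set s]|%:R / #|{: parking_function}|%:R.

Definition park_prob (E : {set 'S_n}) : rat := \sum_(s in E) park_mass s.

(* The k-th letter (1 <= k <= n) of the one-line word of s on {1, ..., n}. *)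
Definition letter s (k : nat) : nat :=
  nth 0%N [seq (s i).+1 | i <- enum 'I_n] k.-1.

End Parking.

(* The exponents of a, b - a and n - b + 1 can be -1, hence integer powers. *)
Definition A_coef (n a b : nat) : rat :=
  ((n - 2)`!%:R * a%:R ^ (a%:Z - 2)
     * (b%:R - a%:R) ^ (b%:Z - a%:Z - 2)
     * (n%:R - b%:R + 1) ^ (n%:Z - b%:Z - 1))
  / ((a - 1)`!%:R * (b - a - 1)`!%:R * (n - b)`!%:R
     * (n%:R + 1) ^+ (n - 1)).

(* Main.v *)
Require Import Defs.
From mathcomp Require Import all_boot all_order all_fingroup all_algebra.
From mathcomp Require Import zify ring.
Import Order.TTheory GRing.Theory Num.Theory.
Set Implicit Arguments.
Unset Strict Implicit.
Unset Printing Implicit Defensive.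
Local Open Scope ring_scope.

(** Cars [n - 1] and [n] end in spaces [l] and [m] exactly when the first
    [n - 2] cars fill all spaces but these two, car [n - 1] then chooses [l]
    and car [n] finally chooses [m].  A car chooses the free space [j] exactly
    when its preference [p] is at most [j] and all of [p, ..., j - 1] are
    taken; such preferences are called the feeders of [j].  The set of feeders
    depends only on the set of occupied spaces, so the number of favourable
    preference sequences is a product of three factors: the number of ways
    for the first [n - 2] cars to fill the complement of [{l, m}], the number
    of feeders of [l] next to it, and the number [m] of feeders of [m] once
    all other spaces are full.  If [l < m] there are [l] feeders of [l]; if
    [m < l] there are [l - m], as they must lie strictly to the right of the
    free space [m].

    Counting the ways to fill a given set [S] is done by looking at the last
    car.  If [H S] is the number of ways for [#|S|] cars to occupy exactly
    [S], then [H S] is the sum over [j] in [S] of the number of feeders of [j]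
    times [H (S :\ j)].  After division by [#|S|!] this recursion
    ([density_rec]) is compatible with products: a space that stays free
    separates the street into two parts that do not interact, and the
    density is multiplicative ([density_split]).  Removing the space [j] from
    an interval leaves two intervals, hence the densities of intervals satisfy
    a closed quadratic recursion; its solution is
    [(k + 1) ^ (k - 1) / k!] by Abel's binomial identity ([abel_identity],
    [density_interval]).  The complement of [{l, m}] consists of three
    intervals, which gives the numerator of [A_n], and the whole street is one
    interval, which gives the [(n + 1) ^ (n - 1)] parking functions of the
    denominator ([card_parking]). *)

(** * Abel's binomial identity *)

(** Pascal's rule turns the sum of order [m + 1] into a difference of two sums
    of order [m]; since [(y + 1) ^+ r - y ^+ r] only contains powers of [y]
    below [r], the induction hypothesis kills every term. *)
Lemma finite_difference0 (R : comNzRingType) (m r : nat) (x : R) : (r < m)%N ->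
  \sum_(j < m.+1) (-1) ^+ j * 'C(m, j)%:R * (x + j%:R) ^+ r = 0.
Proof.
elim: m r x => // m IHm r x; rewrite ltnS => le_rm.
pose f y : R := \sum_(j < m.+1) (-1) ^+ j * 'C(m, j)%:R * (y + j%:R) ^+ r.
have -> : \sum_(j < m.+2) (-1) ^+ j * 'C(m.+1, j)%:R * (x + j%:R) ^+ r
    = f x - f (x + 1).
  rewrite big_ord_recl [X in X + _]/= bin0 expr0 mulr1 mul1r addr0.
  under eq_bigr => j _.
    rewrite lift0 binS natrD mulrDr mulrDl; over.
  rewrite big_split /= addrA; congr (_ + _).
    rewrite big_ord_recr /= bin_small // mulr0 mul0r addr0 /f big_ord_recl /=.
    by rewrite bin0 expr0 mulr1 mul1r addr0.
  rewrite -sumrN; apply: eq_bigr => j _.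
  by rewrite exprS mulN1r !mulNr -addrA nat1r.
rewrite -opprB /f -sumrB.
under eq_bigr => j _.
  rewrite -mulrBr addrAC exprD1n big_ord_recr /= binn mulr1n addrK mulr_sumr.
  over.
rewrite exchange_big big1 ?oppr0 // => i _ /=.
under eq_bigr => j _ do rewrite -(mulr_natl _ 'C(r, i)) mulrCA.
by rewrite -mulr_sumr IHm ?mulr0 // (leq_trans (ltn_ord i)).
Qed.

Lemma mul_bin_trinomial (m j k : nat) : (j + k <= m)%N ->
  ('C(m, j) * 'C(m - j, k) = 'C(m, k) * 'C(m - k, j))%N.
Proof.
move=> le_jkm.
have le_jm : (j <= m)%N by exact: leq_trans (leq_addr _ _) le_jkm.
have le_km : (k <= m)%N by exact: leq_trans (leq_addl _ _) le_jkm.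
apply/eqP; rewrite -(@eqn_pmul2r (j`! * k`! * (m - j - k)`!)); last first.
  by rewrite !muln_gt0 !fact_gt0.
have le_k_mj : (k <= m - j)%N by rewrite leq_subRL.
have le_j_mk : (j <= m - k)%N by rewrite leq_subRL // addnC.
apply/eqP; transitivity m`!.
  by rewrite -(bin_fact le_jm) -(bin_fact le_k_mj); ring.
by rewrite -(bin_fact le_km) -(bin_fact le_j_mk) -!subnDA [(k + j)%N]addnC; ring.
Qed.

(** Abel's identity.  Expanding [(z - j) ^+ (m - j)] around [z = -1] and
    collecting the coefficient of [(z + 1) ^+ k] gives an alternating binomial
    sum of order [m - k] over a power of exponent [m - k - 1].  It vanishes
    unless [k = m].  The exponent [j.-1] replaces the [j - 1] of the
    classical formula: at [j = 0] its base is [1]. *)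
Lemma abel_identity (R : comNzRingType) (m : nat) (z : R) :
  \sum_(j < m.+1) 'C(m, j)%:R * j.+1%:R ^+ j.-1 * (z - j%:R) ^+ (m - j)
    = (z + 1) ^+ m.
Proof.
have expand (j : 'I_m.+1) : 'C(m, j)%:R * j.+1%:R ^+ j.-1 * (z - j%:R) ^+ (m - j)
    = \sum_(k < m.+1) (z + 1) ^+ k * 'C(m, k)%:R * ((-1) ^+ (m - k)
       * ((-1) ^+ j * 'C(m - k, j)%:R * (1 + j%:R) ^+ (m - k).-1)).
  have -> : z - j%:R = - j.+1%:R + (z + 1) by rewrite -natr1; ring.
  have le_jm : (m - j < m.+1)%N by rewrite ltnS leq_subr.
  rewrite exprDn.
  rewrite (big_ord_widen _ (fun k => (- _) ^+ (m - j - k) * (z + 1) ^+ k *+ 'C(m - j, k)) le_jm).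
  rewrite mulr_sumr big_mkcond /=; apply: eq_bigr => k _.
  have -> : (k < (m - j).+1)%N = (j + k <= m)%N by have := ltn_ord j; lia.
  case: leqP => [le_jkm|lt_mjk]; last first.
    by rewrite (@bin_small (m - k)) ?mulr0 ?mul0r ?mulr0 //; have := ltn_ord k; lia.
  have -> : - j.+1%:R = (-1) * (1 + j%:R) :> R by rewrite -natr1; ring.
  rewrite exprMn -[_ *+ 'C(_, k)]mulr_natr.
  have -> : (-1) ^+ (m - j - k) = (-1) ^+ (m - k) * (-1) ^+ j :> R.
    have -> : (m - k = j + (m - j - k))%N by lia.
    by rewrite exprD mulrC signrMK.
  (* For [j = 0] the two exponents differ, but the base is 1. *)
  have -> : (1 + j%:R : R) ^+ (m - k).-1
      = j.+1%:R ^+ j.-1 * (1 + j%:R) ^+ (m - j - k).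
    case: (nat_of_ord j) le_jkm => [|i] le_ikm.
      by rewrite addr0 !expr1n mulr1.
    by rewrite nat1r -exprD /=; congr (_ ^+ _); lia.
  have := mul_bin_trinomial le_jkm => /(congr1 (fun i => i%:R : R)).
  rewrite !natrM => E.
  transitivity ('C(m, j)%:R * 'C(m - j, k)%:R * (j.+1%:R ^+ j.-1
      * ((-1) ^+ (m - k) * (-1) ^+ j * (1 + j%:R) ^+ (m - j - k) * (z + 1) ^+ k))).
    by ring.
  by rewrite E; ring.
rewrite (eq_bigr _ (fun j _ => expand j)) exchange_big big_ord_recr /=.
rewrite big1 ?add0r => [|k _]; last first.
  rewrite -!mulr_sumr.
  have le_mk : ((m - k).+1 <= m.+1)%N by rewrite ltnS leq_subr.
  rewrite [X in _ * (_ * X)](_ : _ = 0) ?mulr0 //.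
  have lt_mk : ((m - k).-1 < m - k)%N by rewrite prednK ?leqnn // subn_gt0.
  rewrite -[RHS](@finite_difference0 R _ _ 1 lt_mk).
  rewrite (big_ord_widen _ (fun j => (-1) ^+ j * 'C(m - k, j)%:R
                                     * (1 + j%:R) ^+ (m - k).-1) le_mk).
  rewrite [RHS]big_mkcond; apply: eq_bigr => j _ /=.
  by rewrite ltnS; case: leqP => // lt_mkj; rewrite bin_small ?mulr0 ?mul0r.
rewrite subnn binn -!mulr_sumr big_ord_recl /=.
rewrite big1 => [|j _]; last by rewrite mulr0 mul0r.
by rewrite !expr0 bin0 !mulr1 addr0 !mulr1.
Qed.

(** The number of parking functions on [k] spaces, divided by [k!]. *)
Definition interval_density (k : nat) : rat := k.+1%:R ^+ k.-1 / k`!%:R.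

(** Abel's identity at [z = k], in exponential form: this is the recursion that
    arises when the last of [k] cars parks in the space [i] of an interval of
    length [k], for which it has [i + 1] preferences. *)
Lemma interval_density_rec (k : nat) :
  \sum_(i < k) i.+1%:R * (interval_density i * interval_density (k - i.+1))
    = k%:R * interval_density k.
Proof.
case: k => [|m]; first by rewrite big_ord0 mul0r.
have fact_neq0 i : i`!%:R != 0 :> rat by rewrite pnatr_eq0 -lt0n fact_gt0.
rewrite /interval_density factS natrM /= invfM.
rewrite mulrCA [_ * (_^-1 * _)]mulrA mulfV ?pnatr_eq0 // mul1r.
have -> : m.+2%:R = m.+1%:R + 1 :> rat by rewrite natr1.
rewrite -abel_identity mulr_suml (reindex_inj rev_ord_inj).
apply: eq_bigr => j _ /=; rewrite subSS.
have le_jm : (j <= m)%N by rewrite -ltnS.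
have -> : (m.+1 - (m - j).+1 = j)%N by lia.
have -> : m.+1%:R - j%:R = (m - j).+1%:R :> rat by rewrite -natrB ?subSn // ltnW.
rewrite -(bin_fact le_jm) !natrM.
have -> : (m - j).+1%:R ^+ (m - j) = (m - j).+1%:R * (m - j).+1%:R ^+ (m - j).-1 :> rat.
  by case: (m - j)%N => [|i]; rewrite ?expr0 ?mulr1 // -exprS.
by field; rewrite !fact_neq0 pnatr_eq0 -lt0n bin_gt0 le_jm.
Qed.

(** * The space chosen by a car *)

Section Streets.
Variable n : nat.
Implicit Types (pref : {ffun 'I_n -> 'I_n}) (st : street n) (S : {set 'I_n}).
Implicit Types (s : seq 'I_n).

Lemma ohead_enum_ordE (P : pred 'I_n) j :
  (ohead [seq i <- enum 'I_n | P i] == Some j)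
    = P j && [forall q : 'I_n, (q < j)%N ==> ~~ P q].
Proof.
have trans_lt : transitive (fun p q : 'I_n => (p < q)%N).
  by move=> q p r; apply: ltn_trans.
have sorted_enum : sorted (fun p q : 'I_n => (p < q)%N) (enum 'I_n).
  by have := iota_ltn_sorted 0 n; rewrite -val_enum_ord sorted_map.
have := sorted_filter trans_lt P sorted_enum.
have mem_r i : (i \in [seq i <- enum 'I_n | P i]) = P i.
  by rewrite mem_filter mem_enum andbT.
case: [seq _ <- _ | _] mem_r => [|j0 r] mem_r /=; first by rewrite -mem_r.
move=> /(order_path_min trans_lt)/allP min_j0.
have Pj0 : P j0 by rewrite -mem_r mem_head.
have le_j0 i : P i -> (j0 <= i)%N.
  by rewrite -mem_r inE => /predU1P[->//|/min_j0/ltnW].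
apply/eqP/andP => [[<-]|[Pj /forallP min_j]].
  by split=> //; apply/forallP=> q; apply/implyP; apply: contraL => /le_j0; rewrite leqNgt.
congr Some; apply/val_inj/eqP; rewrite eqn_leq le_j0 // leqNgt.
by apply: contraL Pj0 => lt_jj0; have := min_j j0; rewrite lt_jj0.
Qed.

Definition occupied st : {set 'I_n} := [set j | st j != None].

(** The preferences that send the next car to [j], when the spaces of [S]
    before [j] are the occupied ones; [S] can be read as the set occupied
    either before or after the arrival of that car, see [feedersD1]. *)
Definition feeders S (j : 'I_n) : {set 'I_n} :=
  [set p : 'I_n | (p <= j)%N
                  && [forall q : 'I_n, (p <= q < j)%N ==> (q \in S)]].

Lemma feedersP S (j p : 'I_n) :
  reflect ((p <= j)%N /\ forall q : 'I_n, (p <= q)%N -> (q < j)%N -> q \in S)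
          (p \in feeders S j).
Proof.
rewrite inE; apply: (iffP andP) => -[-> pS]; split=> //.
  by move=> q le_pq lt_qj; have /forallP/(_ q) := pS; rewrite le_pq lt_qj.
by apply/forallP=> q; apply/implyP=> /andP[]; apply: pS.
Qed.

Lemma feeders_uniq S j j' p : j \notin S -> j' \notin S ->
  p \in feeders S j -> p \in feeders S j' -> j = j'.
Proof.
move=> free_j free_j' /feedersP[le_pj pS] /feedersP[le_pj' pS'].
have [lt_jj'|lt_j'j|/val_inj//] := ltngtP j j'.
  by rewrite pS' in free_j.
by rewrite pS in free_j'.
Qed.

Lemma feedersD1 S (j : 'I_n) : feeders (S :\ j) j = feeders S j.
Proof.
apply/setP=> p; apply/feedersP/feedersP => -[le_pj pS]; split=> // q le_pq lt_qj.
  by have := pS q le_pq lt_qj; rewrite inE => /andP[].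
by rewrite !inE pS // andbT; apply: contraTneq lt_qj => ->; rewrite ltnn.
Qed.

Lemma choose_spaceE st p j :
  (choose_space st p == Some j) = (j \notin occupied st) && (p \in feeders (occupied st) j).
Proof.
rewrite /choose_space inE negbK; case: ifP => [/eqP free_p|/negbT occ_p].
  apply/eqP/andP => [[<-]|[/eqP free_j /feedersP[le_pj occ_pj]]].
    by rewrite free_p eqxx; split=> //; apply/feedersP; split=> // q; lia.
  congr Some; apply/val_inj/eqP; rewrite eqn_leq le_pj leqNgt /=.
  by apply/negP => /(occ_pj p (leqnn p)); rewrite inE free_p.
rewrite ohead_enum_ordE.
apply/andP/andP => [[/andP[lt_pj free_j] /forallP min_j]|[free_j /feedersP[le_pj occ_pj]]].
  split=> //; apply/feedersP; split=> [|q le_pq lt_qj]; first exact: ltnW.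
  rewrite inE; have := min_j q; rewrite lt_qj /= negb_and.
  case/orP => //; rewrite -leqNgt => le_qp.
  by suff -> : q = p by []; apply/val_inj/eqP; rewrite eqn_leq le_qp.
rewrite free_j andbT; split.
  rewrite ltn_neqAle le_pj andbT; apply: contraNneq occ_p => eq_pj.
  by rewrite (val_inj eq_pj).
apply/forallP=> q; apply/implyP=> lt_qj; rewrite negb_and -leqNgt.
case: leqP => //= lt_pq; have := occ_pj q (ltnW lt_pq) lt_qj.
by rewrite inE.
Qed.

(** * The street after a sequence of cars *)

Definition street_after pref s : street n := foldl (park_car pref) [ffun=> None] s.

Lemma street_after_rcons pref s i :
  street_after pref (rcons s i) = park_car pref (street_after pref s) i.
Proof. by rewrite /street_after foldl_rcons. Qed.

Variant park_car_spec pref st i : street n -> Prop :=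
  | Parks j of j \notin occupied st & pref i \in feeders (occupied st) j :
      park_car_spec pref st i [ffun q => if q == j then Some i else st q]
  | Exits of (forall j, ~~ ((j \notin occupied st) && (pref i \in feeders (occupied st) j))) :
      park_car_spec pref st i st.

Lemma park_carP pref st i : park_car_spec pref st i (park_car pref st i).
Proof.
rewrite /park_car; case E: choose_space => [j|].
  by have := eqxx (Some j); rewrite -{1}E choose_spaceE => /andP[]; exact: Parks.
by apply: Exits => j; rewrite -choose_spaceE E.
Qed.

Lemma occupied_park st i j :
  occupied [ffun q => if q == j then Some i else st q] = j |: occupied st.
Proof. by apply/setP=> q; rewrite !inE ffunE; case: (q == j). Qed.

Lemma occupied_start : occupied [ffun=> None] = set0.
Proof. by apply/setP=> j; rewrite !inE ffunE eqxx. Qed.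

Lemma car_arrived pref s i j : street_after pref s j = Some i -> i \in s.
Proof.
elim/last_ind: s => [|s k IHs]; first by rewrite /street_after /= ffunE.
rewrite street_after_rcons mem_rcons inE.
case: park_carP => [j0 _ _|_]; last by move=> /IHs ->; rewrite orbT.
by rewrite ffunE; case: eqP => [_ [->]|_ /IHs ->]; rewrite ?eqxx ?orbT.
Qed.

Lemma card_occupied pref s : (#|occupied (street_after pref s)| <= size s)%N.
Proof.
elim/last_ind: s => [|s k IHs]; first by rewrite occupied_start cards0.
rewrite street_after_rcons size_rcons; case: park_carP => [j free_j _|_].
  by rewrite occupied_park cardsU1 free_j ltnS.
exact: leq_trans IHs (leqnSn _).
Qed.

(** Each car fills at most one space, so as many occupied spaces as arrivals
    means that no car left the street. *)
Lemma all_cars_parked pref s i :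
  #|occupied (street_after pref s)| = size s -> i \in s ->
  exists j, street_after pref s j = Some i.
Proof.
elim/last_ind: s => // s k IHs; rewrite street_after_rcons size_rcons mem_rcons inE.
case: park_carP => [j free_j _|_]; last first.
  by move=> E; have := card_occupied pref s; rewrite E ltnn.
rewrite occupied_park cardsU1 free_j => -[/IHs{}IHs] /predU1P[->|/IHs[q st_q]].
  by exists j; rewrite ffunE eqxx.
exists q; rewrite ffunE ifN //; apply: contraNneq free_j => <-.
by rewrite inE st_q.
Qed.

Lemma is_parkingE pref : is_parking pref = (occupied (final_street pref) == [set: 'I_n]).
Proof.
apply/idP/eqP => [pk|occ_all].
  by apply/setP=> j; rewrite !inE car_atE.
apply/forallP => i; apply/existsP.
have [||j /eqP] := @all_cars_parked pref (enum 'I_n) i; last by exists j.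
  by rewrite -[street_after _ _]/(final_street pref) occ_all cardsT size_enum_ord card_ord.
by rewrite mem_enum.
Qed.

(** The final state of the street, together with the space of the last car,
    can be undone by one step: the street before it is determined, and the
    constraint on the preference of the last car separates from those on the
    earlier ones. *)
Lemma park_lastE pref s i j S : i \notin s ->
  (occupied (street_after pref (rcons s i)) == S)
      && (street_after pref (rcons s i) j == Some i)
  = [&& j \in S, occupied (street_after pref s) == S :\ j & pref i \in feeders S j].
Proof.
move=> i_new; rewrite street_after_rcons; set st := street_after pref s.
have no_i q : st q != Some i by apply: contra i_new => /eqP/car_arrived.
case: park_carP => [j0 free_j0 feed_j0|exits].
  rewrite occupied_park ffunE; apply/andP/and3P => [[/eqP <-]|[jS /eqP occE feed_j]].
    case: (j =P j0) => [->|_]; last by rewrite (negbTE (no_i _)).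
    by move=> _; rewrite -feedersD1 setU1K // setU11.
  have jS' : j \notin occupied st by rewrite occE !inE eqxx.
  have -> : j0 = j.
    by apply: feeders_uniq free_j0 jS' feed_j0 _; rewrite occE feedersD1.
  by rewrite eqxx occE setD1K.
rewrite (negbTE (no_i _)) andbF; apply/esym/negP => /and3P[jS /eqP occE feed_j].
by have := exits j; rewrite occE feedersD1 feed_j setD11.
Qed.

(** * Counting preferences by the set of occupied spaces *)

Definition redirect pref i p : {ffun 'I_n -> 'I_n} :=
  [ffun k => if k == i then p else pref k].

(** Among [n] equally likely preferences of car [i], a proportion [#|A| / n]
    lies in [A], independently of any condition on the other cars.
    Exchanging the preference of [i] with an extra space is an involution
    that proves this. *)
Lemma card_pref_independent (Q : pred {ffun 'I_n -> 'I_n}) i (A : {set 'I_n}) :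
  (forall pref p, Q (redirect pref i p) = Q pref) ->
  (n * #|[set pref | Q pref && (pref i \in A)]| = #|A| * #|[set pref | Q pref]|)%N.
Proof.
move=> Q_indep.
pose swap (x : {ffun 'I_n -> 'I_n} * 'I_n) := (redirect x.1 i x.2, x.1 i).
have swapK : involutive swap.
  case=> pref p; rewrite /swap /= ffunE eqxx; congr pair.
  by apply/ffunP=> k; rewrite !ffunE; case: eqP => // ->.
rewrite [LHS]mulnC [RHS]mulnC.
transitivity (#|[set pref | Q pref && (pref i \in A)]| * #|[set: 'I_n]|)%N.
  by rewrite cardsT card_ord.
rewrite -!cardsX -(card_imset _ (inv_inj swapK)); apply: eq_card => -[pref p].
by rewrite (can_imset_pre _ swapK) !inE /= Q_indep ffunE eqxx andbT.
Qed.

Lemma street_after_redirect pref i p s :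
  i \notin s -> street_after (redirect pref i p) s = street_after pref s.
Proof.
elim/last_ind: s => // s k IHs; rewrite mem_rcons inE negb_or => /andP[ne_ik i_new].
rewrite !street_after_rcons IHs // /park_car /redirect ffunE.
by rewrite eq_sym (negbTE ne_ik).
Qed.

Definition outcomes s S : nat :=
  #|[set pref | occupied (street_after pref s) == S]|.

Lemma card_next_car s i S j : i \notin s ->
  (n * #|[set pref | (occupied (street_after pref s) == S)
               && (pref i \in feeders (j |: S) j)]|
   = #|feeders (j |: S) j| * outcomes s S)%N.
Proof.
move=> i_new; apply: card_pref_independent => pref p.
by rewrite street_after_redirect.
Qed.

(** If [#|S|] cars have filled [S], then the last of them stands in exactly one
    space [j] of [S]; summing over [j] and applying [park_lastE] separates its
    preference from those of its predecessors. *)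
Lemma outcomes_rcons s i S : i \notin s -> #|S| = (size s).+1 ->
  (n * outcomes (rcons s i) S
    = \sum_(j in S) #|feeders S j| * outcomes s (S :\ j))%N.
Proof.
move=> i_new cardS.
transitivity (\sum_(j in S) n * #|[set pref | (occupied (street_after pref s) == S :\ j)
               && (pref i \in feeders S j)]|)%N; last first.
  apply: eq_bigr => j jS; have := card_next_car (S :\ j) j i_new.
  by rewrite setD1K.
rewrite -big_distrr /=; congr (_ * _)%N.
pose P j pref := (occupied (street_after pref (rcons s i)) == S)
      && (street_after pref (rcons s i) j == Some i).
transitivity (\sum_(j in S) #|[set pref | P j pref]|)%N; last first.
  apply: eq_bigr => j jS; apply: eq_card => pref.
  by rewrite [LHS]inE [RHS]inE /P park_lastE // jS.
under eq_bigr => j _ do rewrite -sum1dep_card.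
rewrite /outcomes -sum1dep_card.
rewrite (exchange_big_dep
    (fun pref => occupied (street_after pref (rcons s i)) == S)) /=; last first.
  by move=> j pref _ /andP[].
apply: eq_bigr => pref /eqP occE.
rewrite sum1dep_card.
have [||j st_j] := @all_cars_parked pref (rcons s i) i.
- by rewrite occE size_rcons.
- by rewrite mem_rcons mem_head.
apply/esym; rewrite -(cards1 j); apply: eq_card => q; rewrite !inE.
have jP : P j pref by rewrite /P occE st_j !eqxx.
apply/andP/eqP => [[_ qP]|->]; last first.
  by split=> //; move: jP; rewrite /P park_lastE // => /and3P[].
move: jP qP; rewrite /P !park_lastE // => /and3P[jS /eqP Ej _] /and3P[qS /eqP Eq _].
have := Ej; rewrite Eq => /setP/(_ q); rewrite !inE eqxx /= qS andbT.
by move/esym/negbFE/eqP.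
Qed.

(** The number of ways for [k] cars to fill exactly [S].  It does not refer to
    the cars themselves nor to the preferences of later cars. *)
Fixpoint histories (k : nat) (S : {set 'I_n}) : nat :=
  if k is k'.+1 then (\sum_(j in S) #|feeders S j| * histories k' (S :\ j))%N
  else S == set0.

Lemma outcomesE s S : uniq s -> #|S| = size s ->
  (outcomes s S * n ^ size s = n ^ n * histories (size s) S)%N.
Proof.
elim/last_ind: s S => [|s i IHs] S.
  move=> _ /cards0_eq ->; rewrite /= eqxx !muln1.
  transitivity #|[set: {ffun 'I_n -> 'I_n}]|; last by rewrite cardsT card_ffun card_ord.
  by apply: eq_card => pref; rewrite !inE [street_after _ _]/= occupied_start eqxx.
rewrite rcons_uniq size_rcons => /andP[i_new uniq_s] cardS.
rewrite expnS mulnA [(outcomes _ _ * n)%N]mulnC (outcomes_rcons i_new cardS) /=.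
rewrite big_distrl big_distrr /=.
apply: eq_bigr => j jS; rewrite -mulnA IHs //; first by rewrite mulnCA.
by move: cardS; rewrite (cardsD1 j) jS => -[].
Qed.

(** * Densities of sets of spaces *)

(** The exponential normalisation absorbs the binomial coefficients that count
    the interleavings of cars of different blocks of [S]. *)
Definition density S : rat := (histories #|S| S)%:R / #|S|`!%:R.

Lemma density_rec S :
  #|S|%:R * density S = \sum_(j in S) #|feeders S j|%:R * density (S :\ j).
Proof.
case: (posnP #|S|) => [/eqP|]; first by rewrite cards_eq0 => /eqP ->; rewrite cards0 mul0r big_set0.
case Ek: #|S| => [//|k] _; rewrite /density Ek /= factS natrM invfM mulrCA.
rewrite [_ * (_ / _)]mulrA mulfV ?pnatr_eq0 // mul1r natr_sum mulr_suml.
apply: eq_bigr => j jS; have -> : #|S :\ j| = k.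
  by move: Ek; rewrite (cardsD1 j) jS => -[].
by rewrite natrM mulrA.
Qed.

Lemma density0 : density set0 = 1.
Proof. by rewrite /density cards0 /= eqxx divr1. Qed.

(** No feeder of a space beyond the free space [a] lies before [a], hence the
    feeders in [S1 :|: S2] are those in the part concerned.  Both sides
    then satisfy the same recursion: the sum over [S1] contributes [#|S1|]
    times the product of densities, and the sum over [S2] contributes [#|S2|]
    times it. *)
Lemma density_split (a : 'I_n) (S1 S2 : {set 'I_n}) :
  (forall j, j \in S1 -> j < a)%N -> (forall j, j \in S2 -> a < j)%N ->
  density (S1 :|: S2) = density S1 * density S2.
Proof.
have [m] := ubnP (#|S1| + #|S2|)%N; elim: m S1 S2 => // m IHm S1 S2 le_m S1a S2a.
have disj j : j \in S1 -> j \in S2 -> False.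
  by move=> /S1a lt_ja /S2a; rewrite ltnNge ltnW.
have feeders1 j : j \in S1 -> feeders (S1 :|: S2) j = feeders S1 j.
  move=> /S1a lt_ja; apply/setP=> p; apply/feedersP/feedersP => -[le_pj pS].
    split=> // q le_pq lt_qj; have := pS q le_pq lt_qj; rewrite inE => /orP[//|/S2a].
    by rewrite ltnNge ltnW // (ltn_trans lt_qj).
  by split=> // q le_pq lt_qj; rewrite inE pS.
have feeders2 j : j \in S2 -> feeders (S1 :|: S2) j = feeders S2 j.
  move=> /S2a lt_aj; apply/setP=> p; apply/feedersP/feedersP => -[le_pj pS].
    split=> // q le_pq lt_qj; have := pS q le_pq lt_qj; rewrite inE => /orP[/S1a lt_qa|//].
    have := pS a (leq_trans le_pq (ltnW lt_qa)) lt_aj; rewrite inE.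
    by case/orP=> [/S1a|/S2a]; rewrite ltnn.
  by split=> // q le_pq lt_qj; rewrite inE pS ?orbT.
have cardS : #|S1 :|: S2| = (#|S1| + #|S2|)%N.
  rewrite cardsU (_ : S1 :&: S2 = set0) ?cards0 ?subn0 //.
  by apply/setP=> j; rewrite !inE; apply/negP => /andP[/disj].
have := density_rec (S1 :|: S2); case: (posnP #|S1 :|: S2|) => [/eqP|S_gt0].
  rewrite cards_eq0 setU_eq0 => /andP[/eqP -> /eqP ->] _.
  by rewrite setU0 density0 mulr1.
have S_neq0 : #|S1 :|: S2|%:R != 0 :> rat by rewrite pnatr_eq0 -lt0n.
move=> rec; apply: (mulfI S_neq0); rewrite rec {rec S_neq0}.
rewrite (eq_bigl [predU S1 & S2]) => [|j]; last by rewrite !inE.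
rewrite bigU /=; last first.
  by rewrite disjoint_subset; apply/subsetP=> j jS1; rewrite inE; apply/negP=> /(disj _ jS1).
have -> : \sum_(j in S1) #|feeders (S1 :|: S2) j|%:R * density ((S1 :|: S2) :\ j)
    = #|S1|%:R * density S1 * density S2.
  rewrite density_rec mulr_suml; apply: eq_bigr => j jS1.
  rewrite feeders1 // -mulrA; congr (_ * _); rewrite setDUl.
  have -> : S2 :\ j = S2.
    by apply/setP=> q; rewrite !inE; case: eqP => // ->; apply/esym/negP => /(disj _ jS1).
  apply: IHm => // [|q]; last by rewrite inE => /andP[_ /S1a].
  by move: le_m; rewrite (cardsD1 j S1) jS1.
have -> : \sum_(j in S2) #|feeders (S1 :|: S2) j|%:R * density ((S1 :|: S2) :\ j)
    = #|S2|%:R * density S1 * density S2.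
  rewrite mulrAC density_rec mulr_suml; apply: eq_bigr => j jS2.
  rewrite feeders2 // -mulrA [density _ * density S1]mulrC; congr (_ * _); rewrite setDUl.
  have -> : S1 :\ j = S1.
    by apply/setP=> q; rewrite !inE; case: eqP => // ->; apply/esym/negP => /disj; apply.
  apply: IHm => // [|q]; last by rewrite inE => /andP[_ /S2a].
  by move: le_m; rewrite (cardsD1 j S2) jS2 addnS.
by rewrite cardS natrD; ring.
Qed.

Definition interval (a k : nat) : {set 'I_n} := [set j : 'I_n | (a <= j < a + k)%N].

Lemma big_interval (V : nmodType) (a k : nat) (F : nat -> V) : (a + k <= n)%N ->
  \sum_(j in interval a k) F j = \sum_(i < k) F (a + i)%N.
Proof.
move=> le_akn; rewrite (eq_bigl (fun j : 'I_n => (a <= j < a + k)%N)); last first.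
  by move=> j; rewrite inE.
rewrite -(big_mkord (fun j => (a <= j < a + k)%N)) -[RHS](big_mkord xpredT (fun i => F (a + i)%N)).
rewrite -{2}[k](addKn a) -[in RHS](add0n a).
under [RHS]eq_bigr do rewrite addnC.
rewrite -(big_addn 0 (a + k) a xpredT) add0n (big_nat_widenl a 0) //.
by rewrite (big_nat_widen _ _ _ _ _ le_akn); apply: eq_bigl => j; rewrite andbC.
Qed.

Lemma card_interval (a k : nat) : (a + k <= n)%N -> #|interval a k| = k.
Proof.
move=> le_akn; rewrite -sum1_card (big_interval (fun=> 1%N) le_akn).
by rewrite sum1_card card_ord.
Qed.

(** [a] is the start of the run of occupied spaces that ends just before [j];
    with [a = 0] the run reaches the beginning of the street. *)
Lemma card_feeders S (a : nat) (j : 'I_n) : (a <= j)%N ->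
  (forall q : 'I_n, q.+1 = a -> q \notin S) ->
  (forall q : 'I_n, (a <= q < j)%N -> q \in S) ->
  #|feeders S j| = (j - a).+1.
Proof.
move=> le_aj left_free S_aj.
rewrite -(@card_interval a (j - a).+1); last by rewrite addnS subnKC.
apply: eq_card => p; rewrite [RHS]inE addnS subnKC // ltnS.
apply/feedersP/andP => -[le1 le2]; last first.
  by split=> // q le_pq lt_qj; apply: S_aj; rewrite (leq_trans le1).
split=> //; rewrite leqNgt; apply/negP => lt_pa.
have lt_an : (a.-1 < n)%N by have := ltn_ord j; lia.
have a_gt0 : (0 < a)%N by exact: leq_ltn_trans lt_pa.
have /negP[] := left_free (Ordinal lt_an) (prednK a_gt0).
by apply: le2 => /=; lia.
Qed.

(** The last car to fill an interval leaves behind two shorter intervals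
    separated by its own space, so [density_split] makes the recursion for
    intervals that of [interval_density_rec]. *)
Lemma density_interval (a k : nat) : (a + k <= n)%N ->
  density (interval a k) = interval_density k.
Proof.
have [m] := ubnP k; elim: m a k => // m IHm a k lt_km le_akn.
have := density_rec (interval a k); rewrite card_interval //.
have [->|k_gt0] := posnP k.
  suff -> : interval a 0 = set0 by rewrite density0 /interval_density fact0 divr1 expr0.
  by apply/setP=> j; rewrite !inE addn0; case: leqP => // /ltnW; rewrite ltnNge => ->.
have k_neq0 : k%:R != 0 :> rat by rewrite pnatr_eq0 -lt0n.
move=> rec; apply: (mulfI k_neq0); rewrite rec -interval_density_rec.
pose F i : rat := (i - a).+1%:R * (interval_density (i - a) * interval_density (k - (i - a).+1)).
rewrite (eq_bigr (fun j : 'I_n => F j)); last first.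
  move=> j; rewrite inE => /andP[le_aj lt_jak]; rewrite /F; congr (_%:R * _).
    apply: card_feeders => // q; rewrite inE; last by lia.
    by move=> <-; rewrite ltnn.
  have -> : interval a k :\ j = interval a (j - a) :|: interval j.+1 (k - (j - a).+1).
    apply/setP=> q; rewrite !inE -val_eqE /=; lia.
  rewrite (density_split (a := j)) => [|q|q]; rewrite ?inE; try lia.
  by rewrite !IHm //; lia.
by rewrite big_interval //; apply: eq_bigr => i _; rewrite /F addKn.
Qed.

Lemma density_setT : density [set: 'I_n] = interval_density n.
Proof.
rewrite -(density_interval (leqnn n : (0 + n <= n)%N)); congr density.
by apply/setP=> j; rewrite !inE /= ltn_ord.
Qed.

Lemma density_two_free (a b : 'I_n) : (a < b)%N ->
  density (~: [set a; b])
    = interval_density a * interval_density (b - a.+1) * interval_density (n - b.+1).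
Proof.
move=> lt_ab; have lt_bn := ltn_ord b.
have -> : ~: [set a; b] = interval 0 a :|: (interval a.+1 (b - a.+1) :|: interval b.+1 (n - b.+1)).
  apply/setP=> q; rewrite !inE -!val_eqE /=; have := ltn_ord q; lia.
rewrite (density_split (a := a)) => [|q|q]; rewrite ?inE; try lia.
rewrite (density_split (a := b)) => [|q|q]; rewrite ?inE; try lia.
by rewrite !density_interval ?mulrA //; lia.
Qed.

(** The cars outside [s] are unconstrained, which the powers of [n] account
    for. *)
Lemma outcomes_density s S : uniq s -> #|S| = size s ->
  (outcomes s S)%:R * n%:R ^+ size s = n%:R ^+ n * (size s)`!%:R * density S :> rat.
Proof.
move=> uniq_s cardS; rewrite -!natrX -natrM outcomesE // natrM -mulrA.
by rewrite /density cardS; congr (_ * _); rewrite mulrC divfK // pnatr_eq0 -lt0n fact_gt0.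
Qed.

(** * Parking functions and the last two cars *)

(** Both sides are compared after multiplication by [n ^ n], the total number
    of preference functions, since [outcomes_density] counts proportions. *)
Lemma card_parking : (0 < n)%N ->
  #|{: parking_function n}|%:R = n.+1%:R ^+ n.-1 :> rat.
Proof.
move=> n_gt0; have nX_neq0 : n%:R ^+ n != 0 :> rat by rewrite expf_neq0 // pnatr_eq0 -lt0n.
apply: (mulIf nX_neq0).
have -> : #|{: parking_function n}| = outcomes (enum 'I_n) setT.
  rewrite card_sig /outcomes cardsE; apply: eq_card => pref.
  by rewrite !inE is_parkingE.
have /= := @outcomes_density (enum 'I_n) setT (enum_uniq _).
rewrite size_enum_ord cardsT card_ord => -> //.
rewrite density_setT /interval_density.
by rewrite -mulrA [RHS]mulrC; congr (_ * _); rewrite mulrC divfK // pnatr_eq0 -lt0n fact_gt0.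
Qed.

(** Undoing the two last arrivals by [park_lastE], that of [i2] first, leaves
    one condition on the earlier cars and one on each of the two last
    preferences; these are independent. *)
Lemma card_last_two s i1 i2 (l m : 'I_n) : l != m ->
  uniq (rcons (rcons s i1) i2) -> (size s).+2 = n ->
  let st pref := street_after pref (rcons (rcons s i1) i2) in
  #|[set pref | [&& occupied (st pref) == setT, st pref l == Some i1
                    & st pref m == Some i2]]|%:R
   = #|feeders (~: [set m]) l|%:R * #|feeders setT m|%:R * (size s)`!%:R
     * density (~: [set l; m]) :> rat.
Proof.
move=> ne_lm; rewrite !rcons_uniq mem_rcons inE negb_or.
case/andP=> [/andP[ne_i2 s_i2] /andP[s_i1 uniq_s]] size_s st.
set X := [set pref | _].
have s1_i2 : i2 \notin rcons s i1 by rewrite mem_rcons inE negb_or ne_i2.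
pose Q1 pref := (occupied (street_after pref s) == ~: [set l; m]).
pose Q2 pref := Q1 pref && (pref i1 \in feeders (~: [set m]) l).
have XE : X = [set pref | Q2 pref && (pref i2 \in feeders setT m)].
  apply/setP=> pref; rewrite [LHS]inE [RHS]inE.
  transitivity (((occupied (st pref) == setT) && (st pref m == Some i2)) && (st pref l == Some i1)).
    by rewrite andbA andbAC.
  rewrite /st park_lastE // in_setT /= /Q2 /Q1.
  have -> : ~: [set l; m] = ~: [set m] :\ l by rewrite setDE -setCU setUC.
  have := park_lastE pref l (~: [set m]) s_i1.
  rewrite in_setC in_set1 ne_lm /= => <-.
  rewrite (street_after_rcons pref (rcons s i1)) setTD andbAC; congr (_ && _).
  (* Car [i2] can only enter [m], the one free space, so [l] keeps its car. *)
  case: eqP => //= occE; case: park_carP => // j free_j _.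
  by rewrite ffunE ifN //; apply: contraNneq free_j => <-; rewrite occE in_setC in_set1.
have Q1_indep pref p : Q1 (redirect pref i1 p) = Q1 pref.
  by rewrite /Q1 street_after_redirect.
have Q2_indep : forall pref p, Q2 (redirect pref i2 p) = Q2 pref.
  by move=> pref p; rewrite /Q2 /Q1 street_after_redirect // ffunE ifN // eq_sym.
have n_neq0 : n%:R != 0 :> rat by rewrite -size_s pnatr_eq0.
have nX_neq0 : n%:R ^+ n != 0 :> rat by rewrite expf_neq0.
have nXE : n%:R ^+ n = n%:R * (n%:R * n%:R ^+ size s) :> rat by rewrite -!exprS size_s.
apply: (mulfI nX_neq0).
have count1 := card_pref_independent (feeders (~: [set m]) l) Q1_indep.
have count2 := card_pref_independent (feeders setT m) Q2_indep.
have card_lm : #|~: [set l; m]| = size s.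
  apply/eqP; rewrite -(eqn_add2l #|[set l; m]|) cardsC cards2 ne_lm card_ord.
  exact/eqP/esym/size_s.
have := outcomes_density uniq_s card_lm.
rewrite -[outcomes _ _]/(#|[set pref | Q1 pref]|) => count0.
rewrite XE [in LHS]nXE.
transitivity (n%:R * n%:R ^+ size s
    * (n * #|[set pref | Q2 pref && (pref i2 \in feeders setT m)]|)%N%:R : rat).
  by rewrite natrM; ring.
rewrite count2 natrM.
transitivity (n%:R ^+ size s * #|feeders setT m|%:R * (n * #|[set pref | Q2 pref]|)%N%:R : rat).
  by rewrite natrM; ring.
rewrite count1 natrM.
transitivity (#|feeders setT m|%:R * #|feeders (~: [set m]) l|%:R
    * (#|[set pref | Q1 pref]|%:R * n%:R ^+ size s) : rat); first by ring.
by rewrite count0; ring.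
Qed.

Lemma letterE (s : 'S_n) (i : 'I_n) (k : nat) : k = i.+1 -> letter s k = (s i).+1.
Proof.
move=> ->; rewrite /letter (nth_map i) ?size_enum_ord ?ltn_ord //.
by rewrite nth_ord_enum.
Qed.

Lemma park_prob_card (E : {set 'S_n}) (Q : pred {ffun 'I_n -> 'I_n}) :
  (forall p : parking_function n, (park_perm p \in E) = Q (val p)) ->
  park_prob E = #|[set pref | is_parking pref && Q pref]|%:R / #|{: parking_function n}|%:R.
Proof.
move=> EQ; rewrite /park_prob -mulr_suml -natr_sum; congr (_%:R / _).
transitivity #|@park_perm n @^-1: E|.
  rewrite -sum1_card (partition_big (@park_perm n) (mem E)) /=; last first.
    by move=> p; rewrite inE.
  apply: eq_bigr => s sE; rewrite sum1dep_card; apply: eq_card => p.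
  by rewrite !inE; case: eqP => [->|_]; rewrite ?andbF // sE.
rewrite -(card_imset _ val_inj); apply: eq_card => pref; rewrite inE.
apply/imsetP/andP => [[p]|[pk Qp]]; first by rewrite inE EQ => Qp ->; split=> //; exact: valP.
by exists (Sub pref pk); rewrite ?SubK // inE EQ SubK.
Qed.

End Streets.

Lemma enum_ord_last_two n : exists (s : seq 'I_n.+2) (i1 i2 : 'I_n.+2),
  [/\ enum 'I_n.+2 = rcons (rcons s i1) i2, size s = n, i1 = n :> nat & i2 = n.+1 :> nat].
Proof.
have := size_enum_ord n.+2; have := val_enum_ord n.+2.
case/lastP: (enum _) => [//|s i2]; case/lastP: s => [//|s i1].
rewrite !size_rcons !map_rcons => valE [size_s]; exists s, i1, i2; split=> //.
  have := congr1 (fun r => nth 0%N r n) valE.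
  by rewrite nth_rcons size_rcons size_map size_s ltnSn nth_rcons size_map size_s ltnn eqxx
    nth_iota.
have := congr1 (fun r => nth 0%N r n.+1) valE.
by rewrite nth_rcons size_rcons size_map size_s ltnn eqxx nth_iota.
Qed.

Lemma prob_last_two n (l m : 'I_n.+2) : l != m ->
  park_prob [set s : 'S_n.+2 | (letter s^-1%g n.+1 == l.+1) && (letter s^-1%g n.+2 == m.+1)]
  = #|feeders (~: [set m]) l|%:R * #|feeders setT m|%:R * n`!%:R
    * density (~: [set l; m]) / n.+3%:R ^+ n.+1.
Proof.
move=> ne_lm; have [s [i1 [i2 [enumE size_s i1E i2E]]]] := enum_ord_last_two n.
rewrite (park_prob_card (Q := fun pref =>
    (final_street pref l == Some i1) && (final_street pref m == Some i2))).
  rewrite card_parking //; congr (_ / _).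
  have := @card_last_two _ s i1 i2 _ _ ne_lm.
  rewrite -enumE enum_uniq size_s => /(_ isT erefl) <-.
  by congr _%:R; apply: eq_card => pref; rewrite !inE is_parkingE.
move=> p; rewrite inE (@letterE _ _ i1) ?i1E // (@letterE _ _ i2) ?i2E // !eqSS.
rewrite !(inj_eq val_inj).
have park_permE i j : ((park_perm p)^-1%g i == j) = (final_street (val p) j == Some i).
  rewrite (can2_eq (permKV _) (permK _)) (car_atE _ (valP p)) permE eq_sym.
  by rewrite (inj_eq Some_inj).
by rewrite !park_permE.
Qed.

(** The exponent is [-1] for [k = 0], where the base is [1]. *)
Lemma natr_exprz_pred (k : nat) (e : int) : e = k%:Z - 1 ->
  k.+1%:R ^ e = k.+1%:R ^+ k.-1 :> rat.
Proof.
case: k => [|k] ->; first by rewrite exp1rz expr0.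
by have -> : k.+1%:Z - 1 = k by lia.
Qed.

Lemma A_coefE n a b : (a < b)%N -> (b < n.+2)%N ->
  A_coef n.+2 a.+1 b.+1
  = n`!%:R * (interval_density a * interval_density (b - a.+1) * interval_density (n.+2 - b.+1))
    / n.+3%:R ^+ n.+1.
Proof.
move=> lt_ab lt_bn; rewrite /A_coef /interval_density.
have -> : b.+1%:R - a.+1%:R = (b - a.+1).+1%:R :> rat by rewrite -natrB ?subSn // ?subSS // ltnW.
have -> : n.+2%:R - b.+1%:R + 1 = (n.+2 - b.+1).+1%:R :> rat by rewrite -natrB // natr1.
rewrite !natr_exprz_pred; try lia.
have -> : (b.+1 - a.+1 - 1 = b - a.+1)%N by lia.
have -> : (n.+2 - 2 = n)%N by lia.
by rewrite !subn1 natr1 /= !invfM; ring.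
Qed.

Theorem corollary7 (n : nat) (hn : (2 <= n)%N) :
  (forall l m : nat, (1 <= l)%N -> (l < m)%N -> (m <= n)%N ->
     park_prob [set s : 'S_n | (letter s^-1%g (n - 1) == l)
                               && (letter s^-1%g n == m)]
     = l%:R * m%:R * A_coef n l m)
  /\
  (forall l m : nat, (1 <= m)%N -> (m < l)%N -> (l <= n)%N ->
     park_prob [set s : 'S_n | (letter s^-1%g (n - 1) == l)
                               && (letter s^-1%g n == m)]
     = (l%:R - m%:R) * m%:R * A_coef n m l).
Proof.
case: n hn => [|[|n]] // _; rewrite subn1 /=.
have feeders_all (m : 'I_n.+2) : #|feeders setT m| = m.+1.
  by rewrite (card_feeders (a := 0)) ?subn0 // => q; rewrite in_setT.
split=> -[|l] [|m] // _.
  rewrite ltnS => lt_lm lt_mn.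
  pose l' := Ordinal (ltn_trans lt_lm lt_mn); pose m' := Ordinal lt_mn.
  have := @prob_last_two n l' m'; rewrite -val_eqE /= (ltn_eqF lt_lm) => -> //.
  rewrite feeders_all density_two_free //= A_coefE //.
  rewrite (card_feeders (a := 0)) ?subn0 //=; first by ring.
  move=> q /= lt_ql; rewrite !inE -val_eqE /= neq_ltn.
  by rewrite (ltn_trans lt_ql).
rewrite ltnS => lt_ml lt_ln.
pose m' := Ordinal (ltn_trans lt_ml lt_ln); pose l' := Ordinal lt_ln.
have := @prob_last_two n l' m'; rewrite -val_eqE /= (gtn_eqF lt_ml) => -> //.
rewrite feeders_all setUC density_two_free //= A_coefE //.
rewrite (card_feeders (a := m.+1)) //=; first 1 last.
- by move=> q [Eq]; rewrite !inE -val_eqE /= Eq eqxx.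
- by move=> q /= /andP[lt_mq _]; rewrite !inE -val_eqE /= neq_ltn lt_mq orbT.
have -> : l.+1%:R - m.+1%:R = (l - m.+1).+1%:R :> rat by rewrite -natrB ?subSn ?subSS // ltnW.
by ring.
Qed.
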